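(* Let $T\ge1$ be an integer, let $d_x,d_y\ge1$, let $z_0=(x_0,y_0)\in\mathbb{R}^{d_x}\times\mathbb{R}^{d_y}$, and let $L>0$. Consider any quadratic min-max problem $\min_{x\in\mathbb{R}^{d_x}}\max_{y\in\mathbb{R}^{d_y}} f(x,y)$ with $$f(x,y)=\frac12\begin{bmatrix}x-\tilde x\\ y-\tilde y\end{bmatrix}^\top\mathbf{H}\begin{bmatrix}x-\tilde x\\ y-\tilde y\end{bmatrix},\qquad \mathbf{H}=\begin{bmatrix}\mathbf{A}&\mathbf{B}\\ \mathbf{B}^\top&-\mathbf{C}\end{bmatrix},$$ where $(\tilde x,\tilde y)\in\mathbb{R}^{d_x}\times\mathbb{R}^{d_y}$, and which is convex-concave ($\mathbf{A},\mathbf{C}$ symmetric with $\mathbf{A},\mathbf{C}\succeq0$) and $L$-smooth ($-L\mathbf{I}\preceq\mathbf{H}\preceq L\mathbf{I}$). Run GDA from $z_0$ for $2T$ iterations using the slingshot stepsize schedule for quadratic problems (defined in the context). Then for any saddle point $z^*$ of the problem, $$\|\nabla f(z_{2T})\|\le\frac{L}{2T+1}\,\|z_0-z^*\|.$$ In particular, $\|\nabla f(z_{2T})\|\le\varepsilon$ after $O\!\left(\frac{L\|z_0-z^*\|}{\varepsilon}\right)$ iterations.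
   Context: GDA with stepsizes $\alpha_t,\beta_t\in\mathbb{R}$ is the iteration $x_{t+1}=x_t-\alpha_t\nabla_x f(x_t,y_t)$, $y_{t+1}=y_t+\beta_t\nabla_y f(x_t,y_t)$; write $z_t=(x_t,y_t)$, and $\|\cdot\|$ is the Euclidean norm. A saddle point is a point $z^*=(x^*,y^* )$ with $f(x^*,y)\le f(x^*,y^* )\le f(x,y^* )$ for all $x,y$. Slingshot stepsize schedule for quadratic problems (for $2T$ iterations and smoothness $L$): let $$\rho_t:=L\cos\!\left(\frac{2t+1}{4T+2}\pi\right),\qquad t\in\{0,\dots,2T\}\setminus\{T\},$$ let $h_0,\dots,h_{2T-1}$ be such that $\{h_t^{-1}\}_{t=0}^{2T-1}$ is any permutation of these $2T$ (non-zero) numbers $\rho_t$, and set $$\alpha_t=-\beta_t=h_t,\qquad t\in\{0,1,\dots,2T-1\}.$$ The $O(\cdot)$ hides a universal constant, with $\varepsilon>0$ small enough that the bound is at least of constant order. *)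

(* Defs.v *)
From HB Require Import structures.
From mathcomp Require Import all_boot all_order all_algebra.
From mathcomp Require Import all_classical all_reals all_analysis.

Set Implicit Arguments.
Unset Strict Implicit.
Unset Printing Implicit Defensive.

Import Order.TTheory GRing.Theory Num.Theory.
Import numFieldNormedType.Exports.

Local Open Scope ring_scope.

(* The Euclidean norm; the library's norm on matrices is the sup norm. *)
Definition enorm (R : realType) (n : nat) (v : 'cV[R]_n) : R :=
  Num.sqrt (\sum_(i < n) v i 0 ^+ 2).

Definition stack (R : realType) (dx dy : nat)
  (z : 'cV[R]_dx * 'cV[R]_dy) : 'cV[R]_(dx + dy) := col_mx z.1 z.2.

Definition psd (R : realType) (n : nat) (M : 'M[R]_n) : Prop :=
  M^T = M /\ forall v : 'cV[R]_n, 0 <= (v^T *m M *m v) 0 0.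

Definition loewner_le (R : realType) (n : nat) (M N : 'M[R]_n) : Prop :=
  psd (N - M).

Definition gradient (R : realType) (n : nat) (g : 'cV[R]_n -> R)
  (x : 'cV[R]_n) : 'cV[R]_n :=
  \col_i 'D_(delta_mx i 0) g x.

Section MinMax.
Context {R : realType} {dx dy : nat}.
Implicit Types (f : 'cV[R]_dx -> 'cV[R]_dy -> R) (z : 'cV[R]_dx * 'cV[R]_dy).

Definition grad_x f z : 'cV[R]_dx := gradient (fun x => f x z.2) z.1.

Definition grad_y f z : 'cV[R]_dy := gradient (fun y => f z.1 y) z.2.

Definition grad f z : 'cV[R]_(dx + dy) := col_mx (grad_x f z) (grad_y f z).

Definition saddle_point f z : Prop :=
  forall x y, f z.1 y <= f z.1 z.2 /\ f z.1 z.2 <= f x z.2.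

Fixpoint gda f (alpha beta : nat -> R) (z0 : 'cV[R]_dx * 'cV[R]_dy) (t : nat)
  : 'cV[R]_dx * 'cV[R]_dy :=
  if t is t'.+1 then
    let z := gda f alpha beta z0 t' in
    (z.1 - alpha t' *: grad_x f z, z.2 + beta t' *: grad_y f z)
  else z0.

Definition quad_mx (A : 'M[R]_dx) (B : 'M[R]_(dx, dy)) (C : 'M[R]_dy) :
  'M[R]_(dx + dy) := block_mx A B B^T (- C).

Definition quad_fun (A : 'M[R]_dx) (B : 'M[R]_(dx, dy)) (C : 'M[R]_dy)
  (xt : 'cV[R]_dx) (yt : 'cV[R]_dy) (x : 'cV[R]_dx) (y : 'cV[R]_dy) : R :=
  let w := col_mx (x - xt) (y - yt) in
  2^-1 * (w^T *m quad_mx A B C *m w) 0 0.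

Definition convex_concave (A : 'M[R]_dx) (C : 'M[R]_dy) : Prop :=
  psd A /\ psd C.

Definition smooth (L : R) (A : 'M[R]_dx) (B : 'M[R]_(dx, dy))
  (C : 'M[R]_dy) : Prop :=
  loewner_le (- L)%:M (quad_mx A B C) /\ loewner_le (quad_mx A B C) L%:M.

End MinMax.

Definition rho (R : realType) (L : R) (T t : nat) : R :=
  L * cos ((2 * t + 1)%:R / (4 * T + 2)%:R * pi).

(* Only h 0, ..., h (2T-1) are constrained. A zero h t is excluded: it would
   make (h t)^-1 = 0, whereas rho L T t <> 0 for t <> T when L <> 0. *)
Definition slingshot (R : realType) (L : R) (T : nat) (h : nat -> R) : Prop :=
  perm_eq [seq (h t)^-1 | t <- iota 0 (2 * T)]
          [seq rho L T t | t <- iota 0 (2 * T + 1) & t != T].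

Definition slingshot_gda (R : realType) (dx dy : nat)
  (f : 'cV[R]_dx -> 'cV[R]_dy -> R) (h : nat -> R)
  (z0 : 'cV[R]_dx * 'cV[R]_dy) (t : nat) : 'cV[R]_dx * 'cV[R]_dy :=
  gda f h (fun s => - h s) z0 t.

(* Main.v *)
Require Import Defs.
From mathcomp Require Import all_boot all_order all_algebra.
From mathcomp Require Import all_classical all_reals all_analysis.
From mathcomp Require Import ring lra zify.
Set Implicit Arguments.
Unset Strict Implicit.
Unset Printing Implicit Defensive.
Import Order.TTheory GRing.Theory Num.Theory.
Import numFieldNormedType.Exports.
Local Open Scope ring_scope.

(** For a quadratic objective, [grad f z = Q (z - z~)] with [Q] symmetric, and
    the sign choice [beta_t = - alpha_t] turns gradient descent-ascent into
    plain gradient descent [z_(t+1) = z_t - h_t Q (z_t - z~)]. A saddle point [zs] satisfies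
    [Q (zs - z~) = 0], so after [2T] steps the gradient is [p(Q) (z_0 - zs)]
    with [p(x) = x prod_t (1 - h_t x)].

    Let [n = 2T + 1]. The polynomial [p] has degree [n], vanishes exactly at
    [L] times the roots of the Chebyshev polynomial [T_n] (the middle root is
    [0] because [n] is odd, and supplies the factor [x]), and has slope [1] at
    [0]. Since [T_n] has slope [+n] or [-n] at [0], this forces
    [p(x) = +- (L / n) T_n(x / L)]; see [chebT_slingshot].

    It remains to see that [T_n(S)] is a contraction for [S = Q / L], which
    satisfies [-1 <= S <= 1]. Instead of diagonalizing [S], evaluate the Pell
    identity [T_n^2 + (1 - x^2) U^2 = 1], with [U] the Chebyshev polynomial of
    the second kind of degree [n - 1], at [S]: it gives
    [|v|^2 = |T_n(S) v|^2 + <U(S) v, (1 - S^2) U(S) v>], and the last term is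
    nonnegative ([chebT_contraction]). These two facts are combined in
    [slingshot_contraction]. *)

(** * Chebyshev polynomials *)

(** Multiplication by [x + sqrt(x^2 - 1)] in coordinates: the power
    [(x + sqrt(x^2 - 1))^n] is [chebT n + chebU n * sqrt(x^2 - 1)]. Running both
    sequences together makes each fact below a one-step induction. *)
Definition cheb_step (R : nzRingType) (p : {poly R} * {poly R}) :=
  ('X * p.1 - (1 - 'X ^+ 2) * p.2, 'X * p.2 + p.1).

Definition chebT (R : nzRingType) (n : nat) : {poly R} :=
  (iter n (@cheb_step R) (1, 0)).1.

(** In the usual indexing this is the second-kind polynomial of degree
    [n - 1], so that [chebU R 0 = 0]. *)
Definition chebU (R : nzRingType) (n : nat) : {poly R} :=
  (iter n (@cheb_step R) (1, 0)).2.

Lemma chebTS (R : nzRingType) n :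
  chebT R n.+1 = 'X * chebT R n - (1 - 'X ^+ 2) * chebU R n.
Proof. by rewrite /chebT iterS. Qed.

Lemma chebUS (R : nzRingType) n : chebU R n.+1 = 'X * chebU R n + chebT R n.
Proof. by rewrite /chebU iterS. Qed.

(** The norm of [x + sqrt(x^2 - 1)] is [1], hence so is that of its powers. *)
Lemma cheb_pell (R : comNzRingType) n :
  chebT R n ^+ 2 + (1 - 'X ^+ 2) * chebU R n ^+ 2 = 1.
Proof.
elim: n => [|n IHn]; first by rewrite /chebT /chebU /=; ring.
by rewrite chebTS chebUS -[RHS]IHn; ring.
Qed.

Lemma size_chebTU (R : nzRingType) n :
  (size (chebT R n) <= n.+1)%N && (size (chebU R n) <= n)%N.
Proof.
elim: n => [|n /andP[IHT IHU]]; first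
  by rewrite /chebT /chebU /= size_poly1 size_poly0.
have sX : (size ('X : {poly R}) <= 2)%N by rewrite size_polyX.
have sX2 : (size (1 - 'X ^+ 2 : {poly R})%R <= 3)%N.
  by rewrite (leq_trans (size_polyD _ _)) // size_polyN size_polyXn size_poly1.
have mul (p q : {poly R}) a b : (size p <= a.+1)%N -> (size q <= b)%N ->
    (size (p * q)%R <= a + b)%N.
  move=> pa qb; apply: leq_trans (size_polyMleq p q) _.
  by rewrite -subn1 leq_subLR add1n -addSn leq_add.
rewrite chebTS chebUS; apply/andP; split; apply: leq_trans (size_polyD _ _) _.
  by rewrite size_polyN geq_max (mul _ _ 1%N n.+1) // (mul _ _ 2%N n).
by rewrite geq_max IHT andbT (mul _ _ 1%N n).
Qed.

(** The companion relation [sin x * U (cos x) = sin (n x)] makes the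
    induction the addition formulas of [cos] and [sin]. *)
Lemma chebT_cos (R : realType) n (x : R) : (chebT R n).[cos x] = cos (n%:R * x).
Proof.
suff [] : (chebT R n).[cos x] = cos (n%:R * x) /\
          sin x * (chebU R n).[cos x] = sin (n%:R * x) by [].
elim: n => [|n [IHT IHU]].
  by rewrite /chebT /chebU /= !hornerE cos0 sin0.
rewrite -[n.+1%:R]natr1 mulrDl mul1r cosD sinD -IHT -IHU chebTS chebUS !hornerE.
by rewrite -sin2cos2; split; ring.
Qed.

(** The values at [0] of [T_n' = n U] and
    [(1 - x^2) U' = x U - n T_n], which have to be proved together. *)
Lemma chebT_deriv0 (R : comNzRingType) n :
  (chebT R n)^`().[0] = n%:R * (chebU R n).[0].
Proof.
suff [] : (chebT R n)^`().[0] = n%:R * (chebU R n).[0] /\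
          (chebU R n)^`().[0] = - n%:R * (chebT R n).[0] by [].
elim: n => [|n [IHT IHU]].
  by rewrite /chebT /chebU /= derivC deriv0 !hornerE /= oppr0 ?mul0r.
rewrite chebTS chebUS derivB derivD !derivM derivX derivB derivC derivXn.
rewrite !hornerE IHT IHU -!natr1.
by split; ring.
Qed.

(** The roots of [chebT R (2 * T + 1)], for [t <= 2 * T]. *)
Definition cheb_node (R : realType) (T t : nat) : R :=
  cos ((2 * t + 1)%:R / (4 * T + 2)%:R * pi).

Lemma cheb_node_inj (R : realType) T t s :
  (t <= 2 * T)%N -> (s <= 2 * T)%N ->
  cheb_node R T t = cheb_node R T s -> t = s.
Proof.
have D0 : 0 < (4 * T + 2)%:R :> R by rewrite ltr0n addn2.
have in0pi u : (u <= 2 * T)%N ->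
    (2 * u + 1)%:R / (4 * T + 2)%:R * pi \in `[0 : R, pi].
  move=> uT; rewrite in_itv /=; apply/andP; split.
    by rewrite mulr_ge0 ?pi_ge0 // divr_ge0 ?ler0n.
  rewrite ler_piMl ?pi_ge0 // ler_pdivrMr // mul1r ler_nat.
  by lia.
move=> tT sT /cos_inj -/(_ (in0pi _ tT) (in0pi _ sT)).
move=> /(mulIf (lt0r_neq0 (pi_gt0 R))) /(mulIf (invr_neq0 (lt0r_neq0 D0))).
move=> /eqP; rewrite eqr_nat => /eqP /addIn /eqP.
by rewrite eqn_pmul2l // => /eqP.
Qed.

Lemma cheb_node_root (R : realType) T t :
  root (chebT R (2 * T + 1)) (cheb_node R T t).
Proof.
have -> : root (chebT R (2 * T + 1)) (cheb_node R T t) =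
    (cos (t%:R * pi + pi / 2 : R) == 0).
  rewrite /root chebT_cos; congr (cos _ == 0).
  rewrite (natrD _ (2 * t) 1) (natrD _ (4 * T) 2) !natrM; field.
  by rewrite -natrM -natrD pnatr_eq0 addn2.
elim: t => [|t IHt]; first by rewrite mul0r add0r cos_pihalf.
by rewrite -natr1 mulrDl mul1r addrAC cosDpi oppr_eq0.
Qed.

Lemma cheb_node_mid (R : realType) T : cheb_node R T T = 0.
Proof.
rewrite -[RHS](@cos_pihalf R); congr cos.
rewrite (natrD _ (2 * T) 1) (natrD _ (4 * T) 2) !natrM; field.
by rewrite -natrM -natrD pnatr_eq0 addn2.
Qed.

(** Both sides have the same [2T + 1] distinct roots and the same degree bound,
    so they are proportional; the factor is the derivative of the left side at
    [0], namely [(2T + 1) U(0)], where [U(0)^2 = 1] by the Pell identity. *)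
Lemma chebT_slingshot (R : realType) T : exists2 b : R, b ^+ 2 = 1 &
  chebT R (2 * T + 1) = ((2 * T + 1)%:R * b) *:
    ('X * \prod_(t <- iota 0 (2 * T + 1) | t != T)
            (1 - (cheb_node R T t)^-1 *: 'X)).
Proof.
set n := (2 * T + 1)%N; set P := \prod_(t <- _ | _) _.
have nT : T \in iota 0 n by rewrite mem_iota /= add0n /n; lia.
have iotaP t : t \in iota 0 n -> (t <= 2 * T)%N by rewrite mem_iota /n; lia.
have T0 : (chebT R n).[0] = 0.
  by have /rootP := cheb_node_root R T T; rewrite cheb_node_mid.
exists (chebU R n).[0].
  have /(congr1 (horner^~ 0)) := cheb_pell R n.
  by rewrite !hornerE T0 /= expr0n /= add0r subr0 mul1r expr2.
have [k Ek] : exists k : R, chebT R n = k *: ('X * P).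
  pose rs := [seq cheb_node R T t | t <- iota 0 n].
  have [||q Eq] := @uniq_roots_prod_XsubC _ (chebT R n) rs.
  - by apply/allP => _ /mapP[t _ ->]; apply: cheb_node_root.
  - rewrite uniq_rootsE map_inj_in_uniq ?iota_uniq //.
    by move=> t s /iotaP tT /iotaP sT; apply: cheb_node_inj.
  have [c qE] : exists c, q = c%:P.
    exists q`_0; apply: size1_polyC.
    have [->|q0] := eqVneq q 0; first by rewrite size_poly0.
    have /andP[+ _] := size_chebTU R n.
    rewrite Eq size_Mmonic ?monic_prod_XsubC // size_prod_XsubC size_map.
    rewrite size_iota.
    by rewrite addnS -[X in (_ <= X)%N -> _]add1n leq_add2r.
  (* X - r = -r (1 - r^-1 X) for r <> 0, while the middle node gives 'X *)
  exists (c * \prod_(t <- iota 0 n | t != T) - cheb_node R T t).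
  rewrite Eq qE big_map (bigD1_seq T) ?iota_uniq //= cheb_node_mid subr0.
  rewrite big_seq_cond (eq_bigr (fun t => - cheb_node R T t *:
    (1 - (cheb_node R T t)^-1 *: 'X))); last first.
    move=> t /andP[/iotaP tT tnT].
    have r0 : cheb_node R T t != 0.
      apply: contra tnT => /eqP r0; apply/eqP/(@cheb_node_inj R T) => //.
        by rewrite mul2n -addnn leq_addr.
      by rewrite r0 cheb_node_mid.
    rewrite scalerBr scalerA mulNr divff // scaleN1r opprK addrC alg_polyC.
    by rewrite polyCN.
  by rewrite scaler_prod -!big_seq_cond -/P mul_polyC -scalerAr scalerA.
rewrite -chebT_deriv0; suff <- : k = (chebT R n)^`().[0] by exact: Ek.
rewrite Ek derivZ derivM derivX mul1r !hornerE /P horner_prod.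
rewrite big1 ?mulr1 // => t _.
by rewrite hornerD hornerN hornerZ hornerX hornerC mulr0 subr0.
Qed.

(** * Chebyshev polynomials of a symmetric contraction *)

Lemma enorm_sqr (R : realType) n (v : 'cV[R]_n) : enorm v ^+ 2 = (v^T *m v) 0 0.
Proof.
rewrite /enorm sqr_sqrtr ?sumr_ge0 // => [|i _]; last exact: sqr_ge0.
by rewrite mxE; apply: eq_bigr => i _; rewrite mxE expr2.
Qed.

Lemma enorm_ge0 (R : realType) n (v : 'cV[R]_n) : 0 <= enorm v.
Proof. exact: sqrtr_ge0. Qed.

Lemma enormZ (R : realType) n a (v : 'cV[R]_n) :
  enorm (a *: v) = `|a| * enorm v.
Proof.
rewrite /enorm -sqrtr_sqr -sqrtrM ?sqr_ge0 // mulr_sumr; congr Num.sqrt.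
by apply: eq_bigr => i _; rewrite mxE exprMn.
Qed.

Lemma trmx_horner_mx (R : comNzRingType) n (S : 'M[R]_n.+1) (p : {poly R}) :
  S^T = S -> (horner_mx S p)^T = horner_mx S p.
Proof.
move=> Ssym; elim/poly_ind: p => [|p c IHp]; first by rewrite rmorph0 trmx0.
rewrite rmorphD rmorphM /= horner_mx_X horner_mx_C linearD /= tr_scalar_mx.
rewrite -!mulmxE trmx_mul Ssym IHp.
have /(congr1 (horner_mx S)) := commr_polyX p.
rewrite !rmorphM /= horner_mx_X => E.
by rewrite -!mulmxE in E; rewrite E.
Qed.

Lemma psd_congr (R : realType) n (M N : 'M[R]_n) (v : 'cV[R]_n) :
  N^T = N -> psd M -> 0 <= (v^T *m (N *m M *m N) *m v) 0 0.
Proof.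
move=> Nsym [_ /(_ (N *m v))].
by rewrite trmx_mul Nsym !mulmxA.
Qed.

(** The two factors of [1 - S^2] are psd but their product is not visibly so;
    [2 (1 - S^2) = (1 - S)(1 + S)(1 - S) + (1 + S)(1 - S)(1 + S)] is a sum of
    congruences of psd matrices. *)
Lemma one_sub_sqr_form_ge0 (R : realType) n (S : 'M[R]_n.+1) (v : 'cV[R]_n.+1) :
  psd (1 - S) -> psd (1 + S) -> 0 <= (v^T *m (1 - S ^+ 2) *m v) 0 0.
Proof.
move=> lo hi; have [losym _] := lo; have [hisym _] := hi.
have LR : (1 - S) * (1 + S) = 1 - S ^+ 2.
  by rewrite mulrBl mul1r mulrDr mulr1 opprD addrA addrK.
have RL : (1 + S) * (1 - S) = 1 - S ^+ 2.
  by rewrite mulrDl mul1r mulrBr mulr1 addrA subrK.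
have E : 2 *: (1 - S ^+ 2) =
    (1 - S) *m (1 + S) *m (1 - S) + (1 + S) *m (1 - S) *m (1 + S).
  rewrite !mulmxE LR RL -mulrDr addrACA addNr addr0 mulrDr mulr1.
  by rewrite scaler_nat mulr2n; reflexivity.
rewrite -(@pmulr_rge0 _ 2) ?ltr0n //.
have -> : 2 * (v^T *m (1 - S ^+ 2) *m v) 0 0 =
    (v^T *m (2 *: (1 - S ^+ 2)) *m v) 0 0.
  by rewrite -scalemxAr -scalemxAl [RHS]mxE.
by rewrite E mulmxDr mulmxDl mxE addr_ge0 ?psd_congr.
Qed.

(** Evaluated at [S], the Pell identity splits [|v|^2] into [|T_k(S) v|^2] and
    the form of [1 - S^2] at [U(S) v]. *)
Lemma chebT_contraction (R : realType) n (S : 'M[R]_n.+1) k (v : 'cV[R]_n.+1) :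
  psd (1 - S) -> psd (1 + S) -> enorm (horner_mx S (chebT R k) *m v) <= enorm v.
Proof.
move=> lo hi.
have Ssym : S^T = S.
  have [losym _] := lo; apply: (@subrI _ (1 : 'M[R]_n.+1)).
  by rewrite -[in RHS]losym linearB /= trmx1.
rewrite -(@ler_pXn2r _ 2) ?nnegrE ?enorm_ge0 // !enorm_sqr -subr_ge0.
have := one_sub_sqr_form_ge0 (horner_mx S (chebU R k) *m v) lo hi.
rewrite !trmx_mul !trmx_horner_mx // !mulmxA.
set U := horner_mx S (chebU R k); set T := horner_mx S (chebT R k).
have pell : T *m T + U *m (1 - S ^+ 2) *m U = 1.
  have /(congr1 (horner_mx S)) : chebT R k * chebT R k +
      chebU R k * (1 - 'X ^+ 2) * chebU R k = 1.
    by rewrite -[RHS](cheb_pell R k); ring.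
  by rewrite !(rmorphD, rmorphN, rmorphM, rmorph1, rmorphXn) /= horner_mx_X.
move: pell; set W := 1 - S ^+ 2 => pell W0.
have -> : v^T *m v = v^T *m T *m T *m v + v^T *m U *m W *m U *m v.
  by rewrite -[in LHS](mulmx1 v^T) -[1%:M]/1 -pell mulmxDr mulmxDl !mulmxA.
by rewrite [X in X - _]mxE addrAC subrr add0r.
Qed.

(** * The slingshot product *)

Lemma psdZ (R : realType) n (a : R) (M : 'M[R]_n) :
  0 <= a -> psd M -> psd (a *: M).
Proof.
move=> a0 [Msym Mge0]; split; first by rewrite linearZ /= Msym.
by move=> v; rewrite -scalemxAr -scalemxAl mxE mulr_ge0.
Qed.

(** The steps may come in any order since the factors commute. *)
Lemma slingshot_prod (R : realType) (L : R) T h :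
  slingshot L T h ->
  \prod_(t <- iota 0 (2 * T)) (1 - h t *: 'X) =
  \prod_(t <- iota 0 (2 * T + 1) | t != T)
     (1 - (rho L T t)^-1 *: 'X) :> {poly R}.
Proof.
move=> hP; transitivity
  (\prod_(s <- [seq (h t)^-1 | t <- iota 0 (2 * T)])
      (1 - s^-1 *: 'X) : {poly R}).
  by rewrite big_map; apply: eq_bigr => t _; rewrite invrK.
by rewrite (perm_big _ hP) big_map big_filter.
Qed.

Lemma horner_mx_affine (R : comNzRingType) n (S : 'M[R]_n.+1) a :
  horner_mx S (1 - a *: 'X) = 1 - a *: S.
Proof. by rewrite rmorphB rmorph1 /= horner_mxZ horner_mx_X. Qed.

(** [w t] stands for the difference between the [t]-th iterate and a saddle
    point, on which gradient descent-ascent acts linearly. *)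
Lemma slingshot_contraction (R : realType) N (Q : 'M[R]_N) (L : R) T h
    (w : nat -> 'cV[R]_N) :
  0 < L -> loewner_le (- L)%:M Q -> loewner_le Q L%:M -> slingshot L T h ->
  (forall t, w t.+1 = w t - h t *: (Q *m w t)) ->
  enorm (Q *m w (2 * T)%N) <= L / (2 * T + 1)%:R * enorm (w 0%N).
Proof.
case: N Q w => [|N] Q w L0 lo hi hP wS.
  by rewrite /enorm !big_ord0 sqrtr0 mulr0.
pose S := L^-1 *: Q; have V0 : 0 <= L^-1 by rewrite invr_ge0 ltW.
have {}lo : psd (1 + S).
  have := psdZ V0 lo.
  rewrite /= scalerBr scale_scalar_mx mulrN mulVf ?gt_eqF //.
  by rewrite raddfN opprK addrC.
have {}hi : psd (1 - S).
  have := psdZ V0 hi.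
  by rewrite scalerBr scale_scalar_mx mulVf ?gt_eqF.
have wE n : w n = horner_mx Q (\prod_(t <- iota 0 n) (1 - h t *: 'X)) *m w 0%N.
  elim: n => [|n IHn]; first by rewrite big_nil rmorph1 mul1mx.
  rewrite wS IHn -(addn1 n) iotaD big_cat /= big_seq1 add0n mulrC rmorphM /=.
  rewrite horner_mx_affine -mulmxE -!mulmxA.
  by rewrite mulmxBl mul1mx -scalemxAl.
have [b b2 chebE] := chebT_slingshot R T.
set n := (2 * T + 1)%N in chebE *.
have n0 : 0 < n%:R :> R by rewrite ltr0n /n addn1.
have -> : Q *m w (2 * T)%N =
    (L / n%:R * b) *: (horner_mx S (chebT R n) *m w 0%N).
  rewrite wE (slingshot_prod hP) chebE horner_mxZ -scalemxAl scalerA.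
  have -> : L / n%:R * b * (n%:R * b) = L.
    have nn0 := lt0r_neq0 n0.
    transitivity (L * b ^+ 2); [by field|by rewrite b2 mulr1].
  rewrite rmorphM /= horner_mx_X !rmorph_prod /= -mulmxE -mulmxA /S -scalemxAl.
  rewrite scalerA divff ?gt_eqF // scale1r; congr (_ *m (_ *m _)).
  apply: eq_bigr => t _; rewrite !horner_mx_affine.
  by rewrite scalerA -invfM [_ * L]mulrC.
rewrite enormZ normrM (_ : `|b| = 1); last first.
  by apply/eqP; rewrite -sqrp_eq1 // real_normK ?num_real ?b2.
rewrite mulr1 ger0_norm ?divr_ge0 ?(ltW L0) //.
by rewrite ler_wpM2l ?chebT_contraction // divr_ge0 ?(ltW L0).
Qed.

(** * Quadratic objectives *)

Lemma derive_quadratic (R : realType) (V : normedModType R) (f : V -> R)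
    (a v : V) (l c : R) :
  (forall t, f (a + t *: v) = f a + t * l + t ^+ 2 * c) -> 'D_v f a = l.
Proof.
move=> fE; rewrite /derive.
apply: cvg_lim => //.
apply: (@cvg_trans _ ((fun t => l + t * c) @ 0^')%classic).
  apply: near_eq_cvg; near=> t.
  have t0 : t != 0 by near: t; exact: nbhs_dnbhs_neq.
  rewrite /= [t *: v + a]addrC fE /GRing.scale /=; field.
  exact: t0.
apply: cvg_within_filter.
have : ((fun t => l + t * c) @ (0 : R) --> l + 0 * c)%classic.
  by apply: cvgD; [exact: cvg_cst|apply: cvgMl; exact: cvg_id].
by rewrite mul0r addr0.
Unshelve. all: by end_near.
Qed.

Lemma quad_form_line (R : realType) n (Q : 'M[R]_n) (u d : 'cV[R]_n) (t : R) :
  Q^T = Q ->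
  2^-1 * ((u + t *: d)^T *m Q *m (u + t *: d)) 0 0 =
  2^-1 * (u^T *m Q *m u) 0 0 + t * (d^T *m (Q *m u)) 0 0
  + t ^+ 2 * (2^-1 * (d^T *m Q *m d) 0 0).
Proof.
move=> Qsym.
have E : (u^T *m Q *m d) 0 0 = (d^T *m (Q *m u)) 0 0.
  transitivity ((d^T *m (Q *m u))^T 0 0); last by rewrite [LHS]mxE.
  by rewrite !trmx_mul trmxK Qsym.
have -> : (u + t *: d)^T = u^T + t *: d^T by apply/matrixP => i j; rewrite !mxE.
rewrite !(mulmxDl, mulmxDr) -!(scalemxAl, scalemxAr).
have addE (M N : 'M[R]_1) : (M + N) 0 0 = M 0 0 + N 0 0 by rewrite mxE.
have scaleE a (M : 'M[R]_1) : (a *: M) 0 0 = a * M 0 0 by rewrite mxE.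
rewrite !(addE, scaleE) E -[d^T *m Q *m u]mulmxA.
by field.
Qed.

(** Otherwise a short step against the sign of [a] makes the value negative. *)
Lemma linear_coef_eq0 (R : realFieldType) (a b : R) :
  (forall t, 0 <= t * a + t ^+ 2 * b) -> a = 0.
Proof.
move=> H; have p0 : 0 < 1 + `|b| by rewrite ltr_pwDl.
(* at this step the value is a^2 (b - |b| - 1) / (1 + |b|)^2 *)
have := H (- (a / (1 + `|b|))).
have -> : - (a / (1 + `|b|)) * a + (- (a / (1 + `|b|))) ^+ 2 * b =
    a ^+ 2 * (b - `|b| - 1) / (1 + `|b|) ^+ 2.
  by have p1 := lt0r_neq0 p0; field.
have q0 : b - `|b| - 1 < 0 by have := ler_norm b; lra.
rewrite pmulr_lge0 ?invr_gt0 ?exprn_gt0 // nmulr_lge0 // => a2.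
by apply/eqP; rewrite -sqrf_eq0 eq_le a2 sqr_ge0.
Qed.

Section QuadraticMinMax.
Context (R : realType) (dx dy : nat).
Context (A : 'M[R]_dx) (B : 'M[R]_(dx, dy)) (C : 'M[R]_dy).
Context (xt : 'cV[R]_dx) (yt : 'cV[R]_dy).
Context (Asym : A^T = A) (Csym : C^T = C).

Let f := quad_fun A B C xt yt.
Let Q := quad_mx A B C.
Let w (z : 'cV[R]_dx * 'cV[R]_dy) := stack (z - (xt, yt)).

Lemma quad_mx_sym : Q^T = Q.
Proof. by rewrite /Q /quad_mx tr_block_mx trmxK linearN /= Asym Csym. Qed.

(** One expansion along an arbitrary direction serves twice: its linear
    coefficient is the directional derivative, and it has to vanish at a saddle
    point when the direction moves only one of the two players. *)
Lemma quad_fun_line x y u v t :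
  f (x + t *: u) (y + t *: v) =
  f x y + t * ((col_mx u v)^T *m (Q *m w (x, y))) 0 0
  + t ^+ 2 * (2^-1 * ((col_mx u v)^T *m Q *m col_mx u v) 0 0).
Proof.
rewrite /f /quad_fun -/Q -quad_form_line ?quad_mx_sym //.
by rewrite scale_col_mx add_col_mx !(addrAC _ _ (- _)).
Qed.

Lemma grad_quad_fun z : grad f z = Q *m w z.
Proof.
case: z => x y; rewrite -[RHS]vsubmxK /grad; congr col_mx; apply/matrixP => i j.
  rewrite !mxE; rewrite (ord1 j).
  apply: derive_quadratic => t /=; have := quad_fun_line x y (delta_mx i 0) 0 t.
  rewrite scaler0 addr0 -delta_mx_ushift trmx_delta -rowE => ->.
  by rewrite [(row _ _) _ _]mxE !mxE.
rewrite !mxE; rewrite (ord1 j).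
apply: derive_quadratic => t /=; have := quad_fun_line x y 0 (delta_mx i 0) t.
rewrite scaler0 addr0 -delta_mx_dshift trmx_delta -rowE => ->.
by rewrite [(row _ _) _ _]mxE !mxE.
Qed.

Lemma saddle_stationary z : saddle_point f z -> Q *m w z = 0.
Proof.
case: z => x y zS; rewrite -[LHS]vsubmxK -[RHS]vsubmxK.
congr col_mx; apply/matrixP => i j; rewrite (ord1 j) [LHS]mxE [RHS]mxE [RHS]mxE.
  apply: linear_coef_eq0 => t.
  have [_] := zS (x + t *: delta_mx i 0) y.
  have := quad_fun_line x y (delta_mx i 0) 0 t.
  rewrite scaler0 addr0 -delta_mx_ushift trmx_delta -rowE => -> /=.
  by rewrite -addrA lerDl [(row _ _) _ _]mxE; exact.
apply/eqP; rewrite -oppr_eq0; apply/eqP.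
apply: linear_coef_eq0 => t.
have [+ _] := zS x (y + t *: delta_mx i 0).
have := quad_fun_line x y 0 (delta_mx i 0) t.
rewrite scaler0 addr0 -delta_mx_dshift trmx_delta -rowE => -> /=.
rewrite -addrA gerDl [(row _ _) _ _]mxE -oppr_ge0 opprD -mulrN -mulrN.
by exact.
Qed.

(** The opposite signs of the two stepsizes undo the sign of the ascent. *)
Lemma stack_gda h z0 t : stack (slingshot_gda f h z0 t.+1) =
  stack (slingshot_gda f h z0 t) - h t *: grad f (slingshot_gda f h z0 t).
Proof.
rewrite /slingshot_gda /= /stack /= /grad scale_col_mx opp_col_mx add_col_mx.
by rewrite scaleNr.
Qed.
End QuadraticMinMax.

Lemma slingshot_rate (R : realType) (T dx dy : nat) (L : R)
      (A : 'M[R]_dx) (B : 'M[R]_(dx, dy)) (C : 'M[R]_dy)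
      (xt : 'cV[R]_dx) (yt : 'cV[R]_dy) (z0 : 'cV[R]_dx * 'cV[R]_dy)
      (h : nat -> R) (zs : 'cV[R]_dx * 'cV[R]_dy) :
    0 < L -> convex_concave A C -> smooth L A B C ->
    slingshot L T h ->
    saddle_point (quad_fun A B C xt yt) zs ->
    enorm (grad (quad_fun A B C xt yt)
             (slingshot_gda (quad_fun A B C xt yt) h z0 (2 * T)))
      <= L / (2 * T + 1)%:R * enorm (stack (z0 - zs)).
Proof.
move=> L0 [[Asym _] [Csym _]] [lo hi] hP /(saddle_stationary Asym Csym) zs0.
set f := quad_fun A B C xt yt.
pose v t := stack (slingshot_gda f h z0 t) - stack zs.
have stackB (p q : 'cV[R]_dx * 'cV[R]_dy) : stack (p - q) = stack p - stack q.
  by rewrite /stack opp_col_mx add_col_mx.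
have gradE z : grad f z = quad_mx A B C *m (stack z - stack zs).
  rewrite grad_quad_fun // -[LHS]subr0 -zs0 -mulmxBr !stackB.
  by rewrite opprB addrA subrK.
rewrite gradE stackB.
apply: (slingshot_contraction (w := v) L0 lo hi hP) => t.
by rewrite /v stack_gda -gradE addrAC.
Qed.

(** With [X = L d / eps], the bound holds as soon as [2T + 1 >= X], so
    [T0 = trunc X + 1] is large enough; [X >= c] bounds [2 X + 2] by [K X]. *)
Lemma rate_complexity (R : realType) (c : R) : 0 < c -> exists K : R, 0 < K /\
    forall L d eps : R, 0 < L -> 0 <= d -> 0 < eps -> c <= L * d / eps ->
    exists T0 : nat, (1 <= T0)%N /\ (2 * T0)%:R <= K * (L * d / eps) /\
      forall T, (T0 <= T)%N -> L / (2 * T + 1)%:R * d <= eps.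
Proof.
move=> c0; exists (2 + 2 / c); split; first by rewrite addr_gt0 ?divr_gt0.
move=> L d eps L0 d0 e0; set X := L * d / eps => cX.
have X0 : 0 <= X by rewrite (le_trans (ltW c0)).
exists (Num.trunc X).+1; split=> //; split.
  have /andP[tX _] := truncn_itv X0.
  have : 1 <= X / c by rewrite ler_pdivlMr // mul1r.
  rewrite natrM -natr1 => Xc.
  have -> : (2 + 2 / c) * X = 2 * X + 2 * (X / c) by field; rewrite gt_eqF.
  lra.
move=> T TT; have n0 : 0 < (2 * T + 1)%:R :> R by rewrite ltr0n addn1.
rewrite mulrAC ler_pdivrMr // [eps * _]mulrC -ler_pdivrMr // -/X.
rewrite (le_trans (ltW (truncnS_gt X))) // ler_nat.
by rewrite (leq_trans TT) // mul2n -addnn -addnA leq_addr.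
Qed.

Theorem theorem3p7 (R : realType) :
  (forall (T dx dy : nat) (L : R)
      (A : 'M[R]_dx) (B : 'M[R]_(dx, dy)) (C : 'M[R]_dy)
      (xt : 'cV[R]_dx) (yt : 'cV[R]_dy) (z0 : 'cV[R]_dx * 'cV[R]_dy)
      (h : nat -> R) (zs : 'cV[R]_dx * 'cV[R]_dy),
    (1 <= T)%N -> (1 <= dx)%N -> (1 <= dy)%N -> 0 < L ->
    convex_concave A C -> smooth L A B C ->
    slingshot L T h ->
    saddle_point (quad_fun A B C xt yt) zs ->
    enorm (grad (quad_fun A B C xt yt)
             (slingshot_gda (quad_fun A B C xt yt) h z0 (2 * T)))
      <= L / (2 * T + 1)%:R * enorm (stack (z0 - zs)))
  /\
  (* 2T0 = O(L |z0 - zs| / eps) iterations suffice: c bounds the argument of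
     the O from below, and the hidden constant K may depend on c only *)
  (forall c : R, 0 < c -> exists K : R, 0 < K /\
    forall (dx dy : nat) (L : R)
      (A : 'M[R]_dx) (B : 'M[R]_(dx, dy)) (C : 'M[R]_dy)
      (xt : 'cV[R]_dx) (yt : 'cV[R]_dy) (z0 : 'cV[R]_dx * 'cV[R]_dy)
      (zs : 'cV[R]_dx * 'cV[R]_dy) (eps : R),
    (1 <= dx)%N -> (1 <= dy)%N -> 0 < L ->
    convex_concave A C -> smooth L A B C ->
    saddle_point (quad_fun A B C xt yt) zs ->
    0 < eps -> c <= L * enorm (stack (z0 - zs)) / eps ->
    exists T0 : nat,
      (1 <= T0)%N /\
      (2 * T0)%:R <= K * (L * enorm (stack (z0 - zs)) / eps) /\
      forall (T : nat) (h : nat -> R),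
        (T0 <= T)%N -> slingshot L T h ->
        enorm (grad (quad_fun A B C xt yt)
                 (slingshot_gda (quad_fun A B C xt yt) h z0 (2 * T))) <= eps).
Proof.
split=> [T dx dy L A B C xt yt z0 h zs _ _ _|c c0]; first exact: slingshot_rate.
have [K [K0 HK]] := rate_complexity c0; exists K; split=> //.
move=> dx dy L A B C xt yt z0 zs eps _ _ L0 cc sm sP e0 cX.
have [T0 [T01 [T0K HT]]] := HK _ _ _ L0 (enorm_ge0 _) e0 cX.
exists T0; split=> //; split=> // T h /HT Te hP.
by apply: le_trans Te; apply: slingshot_rate.
Qed.
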